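(* Let $N\ge1$ and let $G=\pi_1(\mathcal{G},G_p,G_e,\mathcal{T})$ be the fundamental quantum group of a graph of compact quantum groups $(\mathcal{G},(G_p)_{p\in V(\mathcal{G})},(G_e)_{e\in E(\mathcal{G})},(s_e)_{e\in E(\mathcal{G})})$ with respect to a maximal subtree $\mathcal{T}\subset\mathcal{G}$, with loop subgroup $\Gamma$. Then, as compact quantum groups, $$G\wr_{*,\widehat{\Gamma}}S_N^+\simeq\pi_1\big(\mathcal{G},\,G_p\wr_*S_N^+,\,G_e\wr_*S_N^+,\,\mathcal{T}\big),$$ where the right-hand side is the fundamental quantum group of the graph of compact quantum groups with structure maps $s_e^N$ defined in the context.
   Context: For a compact quantum group (CQG) $G$, $C(G)$ is its maximal C*-algebra with comultiplication $\Delta_G$. A CQG $H$ is a dual quantum subgroup of $G$ if there is a faithful unital $*$-homomorphism $C(H)\to C(G)$ intertwining the comultiplications. For a discrete group $\Gamma$, $\widehat\Gamma$ is the CQG with $C(\widehat\Gamma)=C^*(\Gamma)$, $\Delta(g)=g\otimes g$. Graphs are in the sense of Serre, at most countable: vertex set $V(\mathcal{G})$, edge set $E(\mathcal{G})$, source $s(e)$, range $r(e)$, inverse edge $\bar e$. A graph of CQGs over a connected graph $\mathcal{G}$ consists of CQGs $G_q$ ($q\in V(\mathcal{G})$), $G_e$ ($e\in E(\mathcal{G})$) with $G_{\bar e}=G_e$, and faithful unital $*$-homomorphisms $s_e:C(G_e)\to C(G_{s(e)})$ intertwining the comultiplications. Put $r_e=s_{\bar e}:C(G_e)\to C(G_{r(e)})$.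 For a maximal subtree $\mathcal{T}$, the fundamental quantum group $G=\pi_1(\mathcal{G},G_p,G_e,\mathcal{T})$ is the CQG whose $C(G)$ is the universal unital C*-algebra generated by the $C(G_q)$, $q\in V(\mathcal{G})$, and unitaries $u_e$, $e\in E(\mathcal{G})$, with relations $u_{\bar e}=u_e^*$, $u_{\bar e}s_e(b)u_e=r_e(b)$ for $b\in C(G_e)$, and $u_e=1$ for $e\in E(\mathcal{T})$; its comultiplication satisfies $\Delta|_{C(G_q)}=\Delta_{G_q}$ and $\Delta(u_e)=u_e\otimes u_e$. The loop subgroup $\Gamma\subset\mathcal{U}(C(G))$ is the group generated by $\{u_e:e\in E(\mathcal{G})\}$; the induced map $C^*(\Gamma)\to C(G)$ is faithful and intertwines the comultiplications, so $\widehat\Gamma$ is a dual quantum subgroup of $G$. $C(S_N^+)$ is the universal unital C*-algebra generated by projections $u_{ij}$, $1\le i,j\le N$, with $\sum_j u_{ij}=1=\sum_j u_{ji}$, and $\Delta(u_{ij})=\sum_k u_{ik}\otimes u_{kj}$. For a dual quantum subgroup $H$ of $G$, $C(G\wr_{*,H}S_N^+)=(C(G)^{*_HN}*C(S_N^+))/I$, where $C(G)^{*_HN}$ is the full free product of $N$ copies of $C(G)$ amalgamated over $C(H)$, $\nu_i$ is the inclusion of the $i$-th copy, and $I$ is the closed two-sided ideal generated by $\nu_i(a)u_{ij}-u_{ij}\nu_i(a)$; the comultiplication is $\Delta(\nu_i(a))=\sum_j(\nu_i\otimes\nu_j)(\Delta_G(a))(u_{ij}\otimes1)$, $\Delta(u_{ij})=\sum_k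 u_{ik}\otimes u_{kj}$. $G\wr_*S_N^+$ is the case of trivial $H$. $s_e^N:C(G_e\wr_*S_N^+)\to C(G_{s(e)}\wr_*S_N^+)$ is the unique unital $*$-homomorphism with $s_e^N\circ\nu_i=\nu_i\circ s_e$ for all $i$ and $s_e^N|_{C(S_N^+)}=\mathrm{id}$; it is faithful and intertwines the comultiplications. *)

(* Defs.v *)
From HB Require Import structures.
From mathcomp Require Import all_boot all_order all_algebra.
From mathcomp Require Import complex.
From mathcomp Require Import all_classical all_reals all_analysis.

Set Implicit Arguments.
Unset Strict Implicit.
Unset Printing Implicit Defensive.

Import Order.TTheory GRing.Theory Num.Theory numFieldNormedType.Exports.

Local Open Scope classical_set_scope.
Local Open Scope ring_scope.

(* [algType] makes [1 != 0], so the zero algebra is excluded. *)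
HB.mixin Record isCStar (R : realType) A of GRing.Algebra R[i] A := {
  star : A -> A;
  starK : involutive star;
  starD : forall x y : A, star (x + y) = star x + star y;
  starZ : forall (c : R[i]) (x : A), star (c *: x) = c^* *: star x;
  starM : forall x y : A, star (x * y) = star y * star x;
  cnorm : A -> R;
  cnorm_eq0 : forall x : A, cnorm x = 0 -> x = 0;
  ler_cnormD : forall x y : A, cnorm (x + y) <= cnorm x + cnorm y;
  cnormZ : forall (c : R[i]) (x : A),
    (cnorm (c *: x))%:C%C = `|c| * (cnorm x)%:C%C;
  ler_cnormM : forall x y : A, cnorm (x * y) <= cnorm x * cnorm y;
  cstar_identity : forall x : A, cnorm (star x * x) = cnorm x ^+ 2;
  cnorm_complete : forall u : nat -> A,
    (forall e : R, 0 < e -> exists n0, forall m n, (n0 <= m)%N -> (n0 <= n)%N ->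
       cnorm (u m - u n) < e) ->
    exists l : A, cnorm (u n - l) @[n --> \oo] --> (0 : R)
}.

#[short(type="cstarType")]
HB.structure Definition CStar (R : realType) :=
  {A of GRing.Algebra R[i] A & isCStar R A}.

HB.mixin Record isStarMap (R : realType) (A B : cstarType R) (f : A -> B) := {
  star_map : forall x : A, f (star x) = star (f x)
}.

HB.structure Definition StarHom (R : realType) (A B : cstarType R) :=
  {f of isStarMap R A B f & @GRing.LRMorphism R[i] A B *:%R f}.

Notation "{ 'shom' A -> B }" := (StarHom.type A B)
  (at level 0, A at level 98, B at level 99, format "{ 'shom'  A  ->  B }").

Section Comp.
Context (R : realType) (A B C : cstarType R).
Context (g : {shom B -> C}) (f : {shom A -> B}).

Lemma comp_star_map (x : A) : (g \o f) (star x) = star ((g \o f) x).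
Proof. by rewrite /= !star_map. Qed.

HB.instance Definition _ := isStarMap.Build R A C (g \o f) comp_star_map.
End Comp.

Definition scomp (R : realType) (A B C : cstarType R)
  (g : {shom B -> C}) (f : {shom A -> B}) : {shom A -> C} := g \o f.

Definition unique_shom (R : realType) (A B : cstarType R)
    (Q : {shom A -> B} -> Prop) : Prop :=
  (exists phi, Q phi) /\ forall phi psi, Q phi -> Q psi -> phi =1 psi.

Definition lspan (R : realType) (A : cstarType R) (X : set A) : set A :=
  [set x | exists n (c : 'I_n -> R[i]) (a : 'I_n -> A),
     (forall i, X (a i)) /\ x = \sum_(i < n) c i *: a i].

Definition cclosure (R : realType) (A : cstarType R) (X : set A) : set A :=
  [set x | forall e : R, 0 < e -> exists2 y, X y & cnorm (x - y) < e].

Definition closed_ideal (R : realType) (A : cstarType R) (I : set A) : Prop :=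
  [/\ cclosure I `<=` I, I 0, forall x y, I x -> I y -> I (x + y)
    & forall a x b, I x -> I (a * x * b)].

Definition closed_ideal_gen (R : realType) (A : cstarType R) (X : set A) :
    set A :=
  \bigcap_(I in [set I | closed_ideal I /\ X `<=` I]) I.

Section Unitary.
Context (R : realType) (A : cstarType R).

Definition is_unitary : pred A :=
  fun x => (star x * x == 1) && (x * star x == 1).

Record unitary := Unitary { uval : A; uvalP : is_unitary uval }.

HB.instance Definition _ := [isSub for uval].
HB.instance Definition _ := [Choice of unitary by <:].

Lemma star1 : star (1 : A) = 1.
Proof. by rewrite -[LHS]mulr1 -[X in _ * X]starK -starM mulr1 starK. Qed.

Lemma unitary1 : is_unitary 1.
Proof. by rewrite /is_unitary star1 mulr1 eqxx. Qed.

Lemma unitaryM (u v : unitary) : is_unitary (uval u * uval v).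
Proof.
have /andP[/eqP u1 /eqP u2] := uvalP u; have /andP[/eqP v1 /eqP v2] := uvalP v.
rewrite /is_unitary starM; apply/andP; split; apply/eqP.
  by rewrite mulrA -(mulrA (star (uval v))) u1 mulr1 v1.
by rewrite mulrA -(mulrA (uval u)) v2 mulr1 u2.
Qed.

Lemma unitaryV (u : unitary) : is_unitary (star (uval u)).
Proof. by rewrite /is_unitary starK andbC; exact: uvalP. Qed.

Definition uone := Unitary unitary1.
Definition umul u v := Unitary (unitaryM u v).
Definition uinv u := Unitary (unitaryV u).

Lemma umulA : associative umul.
Proof. by move=> u v w; apply: val_inj; rewrite /= mulrA. Qed.
Lemma umul1 : left_id uone umul.
Proof. by move=> u; apply: val_inj; rewrite /= mul1r. Qed.
Lemma umulr1 : right_id uone umul.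
Proof. by move=> u; apply: val_inj; rewrite /= mulr1. Qed.
Lemma umulV : left_inverse uone uinv umul.
Proof. by move=> u; apply: val_inj => /=; have /andP[/eqP] := uvalP u. Qed.
Lemma umulrV : right_inverse uone uinv umul.
Proof. by move=> u; apply: val_inj => /=; have /andP[_ /eqP] := uvalP u. Qed.

HB.instance Definition _ :=
  isGroup.Build unitary umulA umul1 umulr1 umulV umulrV.
End Unitary.

Section GeneratedSubgroup.
Context (G : groupType) (X : set G).

Inductive generated : G -> Prop :=
| gen_in x : X x -> generated x
| gen_one : generated 1%g
| gen_mul x y : generated x -> generated y -> generated (x * y)%g
| gen_inv x : generated x -> generated (x^-1)%g.

Record subgroup_gen := SubgroupGen {
  sgval_gen : G;
  sgenP : `[< generated sgval_gen >]
}.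

HB.instance Definition _ := [isSub for sgval_gen].
HB.instance Definition _ := [Choice of subgroup_gen by <:].

Lemma sgen1 : `[< generated 1%g >].
Proof. by apply/asboolP; exact: gen_one. Qed.
Lemma sgenM (x y : subgroup_gen) : `[< generated (sgval_gen x * sgval_gen y)%g >].
Proof. by apply/asboolP; apply: gen_mul; exact/asboolP/sgenP. Qed.
Lemma sgenV (x : subgroup_gen) : `[< generated ((sgval_gen x)^-1)%g >].
Proof. by apply/asboolP; apply: gen_inv; exact/asboolP/sgenP. Qed.

Definition sg_one := SubgroupGen sgen1.
Definition sg_mul x y := SubgroupGen (sgenM x y).
Definition sg_inv x := SubgroupGen (sgenV x).

Lemma sg_mulA : associative sg_mul.
Proof. by move=> x y z; apply: val_inj; rewrite /= mulgA. Qed.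
Lemma sg_mul1 : left_id sg_one sg_mul.
Proof. by move=> x; apply: val_inj; rewrite /= mul1g. Qed.
Lemma sg_mulr1 : right_id sg_one sg_mul.
Proof. by move=> x; apply: val_inj; rewrite /= mulg1. Qed.
Lemma sg_mulV : left_inverse sg_one sg_inv sg_mul.
Proof. by move=> x; apply: val_inj; rewrite /= mulVg. Qed.
Lemma sg_mulrV : right_inverse sg_one sg_inv sg_mul.
Proof. by move=> x; apply: val_inj; rewrite /= mulgV. Qed.

HB.instance Definition _ :=
  isGroup.Build subgroup_gen sg_mulA sg_mul1 sg_mulr1 sg_mulV sg_mulrV.
End GeneratedSubgroup.

(* [T] is the completion of the algebraic tensor product of [A] and [B] for some
   C*-norm: [tl a = a (x) 1] and [tr b = 1 (x) b] commute, the span of the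
   [tl a * tr b] is dense, and [tinj] is injectivity on the algebraic tensor
   product, tested on tensors written with linearly independent left legs. *)
Record cstar_tensor (R : realType) (A B T : cstarType R) := CStarTensor {
  tl : {shom A -> T};
  tr : {shom B -> T};
  tcomm : forall a b, tl a * tr b = tr b * tl a;
  tdense : cclosure (lspan [set x | exists a b, x = tl a * tr b]) = setT;
  tinj : forall n (a : 'I_n -> A) (b : 'I_n -> B),
    (forall c : 'I_n -> R[i],
       \sum_(i < n) c i *: a i = 0 -> forall i, c i = 0) ->
    \sum_(i < n) tl (a i) * tr (b i) = 0 -> forall i, b i = 0
}.

Definition tpair (R : realType) (A B T : cstarType R) (t : cstar_tensor A B T)
  (a : A) (b : B) : T := tl t a * tr t b.

(* The least C*-norm is the spatial one (Takesaki), so this is the minimal, or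
   spatial, tensor product. *)
Record min_tensor (R : realType) (A B T : cstarType R) := MinTensor {
  mt_tensor :> cstar_tensor A B T;
  mt_min : forall (T' : cstarType R) (t' : cstar_tensor A B T')
      n (a : 'I_n -> A) (b : 'I_n -> B),
    cnorm (\sum_(i < n) tpair mt_tensor (a i) (b i))
      <= cnorm (\sum_(i < n) tpair t' (a i) (b i))
}.

(* [h] is the homomorphism f (x) g. *)
Definition is_tensor_hom (R : realType) (A B T A' B' T' : cstarType R)
    (t : cstar_tensor A B T) (t' : cstar_tensor A' B' T')
    (f : {shom A -> A'}) (g : {shom B -> B'}) (h : {shom T -> T'}) : Prop :=
  (forall a, h (tl t a) = tl t' (f a)) /\ (forall b, h (tr t b) = tr t' (g b)).

Section CQGAxioms.
Context (R : realType) (A T : cstarType R) (t : min_tensor A A T).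
Context (D : {shom A -> T}).

(* [T3] is (A (x) A) (x) A, [Did] is D (x) id and [idD] is id (x) D; the latter
   is written through [e], which maps x (x) y to (1 (x) x) (x) y. *)
Definition coassociative : Prop :=
  exists (T3 : cstarType R) (t3 : min_tensor T A T3)
    (Did e idD : {shom T -> T3}),
  [/\ (forall x, Did (tl t x) = tl t3 (D x)) /\
        (forall y, Did (tr t y) = tr t3 y),
      (forall x, e (tl t x) = tl t3 (tr t x)) /\
        (forall y, e (tr t y) = tr t3 y),
      (forall x, idD (tl t x) = tl t3 (tl t x)) /\
        (forall y, idD (tr t y) = e (D y))
    & forall x, Did (D x) = idD (D x)].

Definition cancellation : Prop :=
  cclosure (lspan [set z | exists x y, z = D x * tl t y]) = setT /\
  cclosure (lspan [set z | exists x y, z = D x * tr t y]) = setT.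

Definition unitary_rep n (v : 'M[A]_n) : Prop :=
  [/\ forall i j, \sum_k star (v k i) * v k j = (i == j)%:R,
      forall i j, \sum_k v i k * star (v j k) = (i == j)%:R
    & forall i j, D (v i j) = \sum_k tpair t (v i k) (v k j)].

(* The Hopf *-algebra of coefficients of finite-dimensional unitary
   representations. *)
Definition Pol : set A :=
  lspan [set x | exists n (v : 'M[A]_n) i j, unitary_rep v /\ x = v i j].

(* [A] is the enveloping C*-algebra of [Pol]; only the values of [f] on [Pol]
   matter. *)
Definition maximal : Prop :=
  forall (B : cstarType R) (f : A -> B),
    f 1 = 1 ->
    (forall (c : R[i]) x y, Pol x -> Pol y -> f (c *: x + y) = c *: f x + f y) ->
    (forall x y, Pol x -> Pol y -> f (x * y) = f x * f y) ->
    (forall x, Pol x -> f (star x) = star (f x)) ->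
  exists phi : {shom A -> B}, forall x, Pol x -> phi x = f x.
End CQGAxioms.

(* [cqg_alg G] is the maximal C*-algebra C(G), [cqg_T G] its minimal tensor
   square. *)
Record cqg (R : realType) := CQG {
  cqg_alg :> cstarType R;
  cqg_T : cstarType R;
  cqg_t : min_tensor cqg_alg cqg_alg cqg_T;
  cqg_D : {shom cqg_alg -> cqg_T};
  cqg_coassoc : coassociative cqg_t cqg_D;
  cqg_cancel : cancellation cqg_t cqg_D;
  cqg_max : maximal cqg_t cqg_D
}.

Definition intertwines (R : realType) (G H : cqg R) (f : {shom G -> H}) : Prop :=
  exists h : {shom cqg_T G -> cqg_T H},
    is_tensor_hom (cqg_t G) (cqg_t H) f f h /\
    forall a, cqg_D H (f a) = h (cqg_D G a).

Definition cqg_iso (R : realType) (G H : cqg R) : Prop :=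
  exists phi : {shom G -> H}, bijective phi /\ intertwines phi.

Record dual_subgroup (R : realType) (H G : cqg R) := DualSubgroup {
  ds_hom :> {shom H -> G};
  ds_inj : injective ds_hom;
  ds_intertwines : intertwines ds_hom
}.

Definition trivial_cqg (R : realType) (G : cqg R) : Prop :=
  forall x : G, exists c : R[i], x = c *: 1.

(* [H] is the dual of the discrete group [Gam]: C(H) is the full group
   C*-algebra, with canonical unitaries [gd_elt g]. *)
Record group_dual (R : realType) (Gam : groupType) (H : cqg R) := GroupDual {
  gd_elt : Gam -> unitary H;
  gd_mul : forall g h, gd_elt (g * h)%g = (gd_elt g * gd_elt h)%g;
  gd_univ : forall (B : cstarType R) (v : Gam -> unitary B),
    (forall g h, v (g * h)%g = (v g * v h)%g) ->
    unique_shom (fun phi : {shom H -> B} =>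
      forall g, phi (uval (gd_elt g)) = uval (v g));
  gd_D : forall g,
    cqg_D H (uval (gd_elt g)) =
    tpair (cqg_t H) (uval (gd_elt g)) (uval (gd_elt g))
}.

Definition magic_unitary (R : realType) (A : cstarType R) N
    (u : 'I_N -> 'I_N -> A) : Prop :=
  [/\ forall i j, star (u i j) = u i j, forall i j, u i j * u i j = u i j,
      forall i, \sum_j u i j = 1 & forall i, \sum_j u j i = 1].

Record quantum_perm (R : realType) N (S : cqg R) := QuantumPerm {
  qp_u : 'I_N -> 'I_N -> S;
  qp_magic : magic_unitary qp_u;
  qp_univ : forall (B : cstarType R) (v : 'I_N -> 'I_N -> B),
    magic_unitary v ->
    unique_shom (fun phi : {shom S -> B} =>
      forall i j, phi (qp_u i j) = v i j);
  qp_D : forall i j,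
    cqg_D S (qp_u i j) = \sum_k tpair (cqg_t S) (qp_u i k) (qp_u k j)
}.

(* [F] is the full free product of [N] copies of [A] amalgamated over [C]. *)
Record amalgam (R : realType) N (C A : cstarType R) (iota : {shom C -> A})
    (F : cstarType R) := Amalgam {
  am_base : {shom C -> F};
  am_nu : 'I_N -> {shom A -> F};
  am_rel : forall i c, am_nu i (iota c) = am_base c;
  am_univ : forall (B : cstarType R) (f0 : {shom C -> B})
      (f : 'I_N -> {shom A -> B}),
    (forall i c, f i (iota c) = f0 c) ->
    unique_shom (fun phi : {shom F -> B} =>
      (forall c, phi (am_base c) = f0 c) /\
      (forall i a, phi (am_nu i a) = f i a))
}.

Record free_product (R : realType) (A B F : cstarType R) := FreeProduct {
  fp_l : {shom A -> F};
  fp_r : {shom B -> F};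
  fp_univ : forall (E : cstarType R) (f : {shom A -> E}) (g : {shom B -> E}),
    unique_shom (fun phi : {shom F -> E} =>
      (forall a, phi (fp_l a) = f a) /\ (forall b, phi (fp_r b) = g b))
}.

Record cstar_quotient (R : realType) (A : cstarType R) (I : set A)
    (Q : cstarType R) := CStarQuotient {
  cq_pi :> {shom A -> Q};
  cq_surj : forall y, exists x, cq_pi x = y;
  cq_ker : forall x, cq_pi x = 0 <-> I x
}.

Definition wreath_relators (R : realType) N (S : cqg R) (qp : quantum_perm N S)
    (H G : cqg R) (iota : {shom H -> G}) (F E : cstarType R)
    (am : amalgam N iota F) (fp : free_product F S E) : set E :=
  [set z | exists i j (a : G),
     z = fp_l fp (am_nu am i a) * fp_r fp (qp_u qp i j)
         - fp_r fp (qp_u qp i j) * fp_l fp (am_nu am i a)].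

Record wreath_alg (R : realType) N (S : cqg R) (qp : quantum_perm N S)
    (H G : cqg R) (iota : {shom H -> G}) (W : cstarType R) := WreathAlg {
  wr_F : cstarType R;
  wr_am : amalgam N iota wr_F;
  wr_E : cstarType R;
  wr_fp : free_product wr_F S wr_E;
  wr_pi : cstar_quotient (closed_ideal_gen (wreath_relators qp wr_am wr_fp)) W
}.

Definition wr_nu (R : realType) N (S : cqg R) (qp : quantum_perm N S)
    (H G : cqg R) (iota : {shom H -> G}) (W : cstarType R)
    (w : wreath_alg qp iota W) (i : 'I_N) : {shom G -> W} :=
  scomp (wr_pi w) (scomp (fp_l (wr_fp w)) (am_nu (wr_am w) i)).

Definition wr_perm (R : realType) N (S : cqg R) (qp : quantum_perm N S)
    (H G : cqg R) (iota : {shom H -> G}) (W : cstarType R)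
    (w : wreath_alg qp iota W) : {shom S -> W} :=
  scomp (wr_pi w) (fp_r (wr_fp w)).

Record wreath (R : realType) N (S : cqg R) (qp : quantum_perm N S)
    (H G : cqg R) (iota : dual_subgroup H G) (W : cqg R) := Wreath {
  wr_alg :> wreath_alg qp iota W;
  wr_D_nu : forall i, exists h : 'I_N -> {shom cqg_T G -> cqg_T W},
    (forall j, is_tensor_hom (cqg_t G) (cqg_t W)
                 (wr_nu wr_alg i) (wr_nu wr_alg j) (h j)) /\
    forall a, cqg_D W (wr_nu wr_alg i a) =
      \sum_j h j (cqg_D G a) * tl (cqg_t W) (wr_perm wr_alg (qp_u qp i j));
  wr_D_perm : forall i j,
    cqg_D W (wr_perm wr_alg (qp_u qp i j)) =
    \sum_k tpair (cqg_t W) (wr_perm wr_alg (qp_u qp i k))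
                           (wr_perm wr_alg (qp_u qp k j))
}.

Record free_wreath (R : realType) N (S : cqg R) (qp : quantum_perm N S)
    (G W : cqg R) := FreeWreath {
  fw_H : cqg R;
  fw_trivial : trivial_cqg fw_H;
  fw_iota : dual_subgroup fw_H G;
  fw_wreath :> wreath qp fw_iota W
}.

(* The range of an edge is the source of its inverse. *)
Record sgraph := SGraph {
  vert : Type;
  edge : Type;
  src : edge -> vert;
  bar : edge -> edge;
  barK : involutive bar;
  bar_neq : forall e, bar e <> e;
  vert_countable : countable [set: vert];
  edge_countable : countable [set: edge]
}.

Definition rng (X : sgraph) (e : edge X) : vert X := src (bar e).

Fixpoint walk (X : sgraph) (x : vert X) (p : seq (edge X)) (y : vert X) : Prop :=
  if p is e :: p' then src e = x /\ walk (rng e) p' y else x = y.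

Fixpoint all_in (T : Type) (A : set T) (p : seq T) : Prop :=
  if p is e :: p' then A e /\ all_in A p' else True.

Definition connected_graph (X : sgraph) : Prop :=
  (exists x : vert X, True) /\ forall x y : vert X, exists p, walk x p y.

Record subgraph (X : sgraph) := Subgraph {
  sub_vert : set (vert X);
  sub_edge : set (edge X);
  sub_src : forall e, sub_edge e -> sub_vert (src e);
  sub_bar : forall e, sub_edge e -> sub_edge (bar e)
}.

Definition reduced (X : sgraph) (p : seq (edge X)) : Prop :=
  forall p1 e p2, p <> p1 ++ e :: bar e :: p2.

Definition is_tree (X : sgraph) (T : subgraph X) : Prop :=
  [/\ exists x, sub_vert T x,
      forall x y, sub_vert T x -> sub_vert T y ->
        exists p, all_in (sub_edge T) p /\ walk x p y
    & forall x p, all_in (sub_edge T) p -> walk x p x -> reduced p -> p = [::]].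

Definition maximal_subtree (X : sgraph) (T : subgraph X) : Prop :=
  is_tree T /\
  forall T' : subgraph X, is_tree T' ->
    sub_vert T `<=` sub_vert T' -> sub_edge T `<=` sub_edge T' ->
    sub_vert T' = sub_vert T /\ sub_edge T' = sub_edge T.

Definition cqg_cast (R : realType) (G H : cqg R) (eqGH : G = H) : G -> H :=
  match eqGH in _ = K return G -> K with erefl => id end.

Record cqg_graph (R : realType) (X : sgraph) := CQGGraph {
  gv : vert X -> cqg R;
  ge : edge X -> cqg R;
  ge_bar : forall e, ge (bar e) = ge e;
  gs : forall e, {shom ge e -> gv (src e)};
  gs_inj : forall e, injective (gs e);
  gs_intertwines : forall e, intertwines (gs e)
}.

Definition gr (R : realType) (X : sgraph) (GG : cqg_graph R X) (e : edge X)
    (b : ge GG e) : gv GG (rng e) :=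
  gs GG (bar e) (cqg_cast (esym (ge_bar GG e)) b).

Definition fundamental_rel (R : realType) (X : sgraph) (GG : cqg_graph R X)
    (T : subgraph X) (B : cstarType R)
    (f : forall q, {shom gv GG q -> B}) (u : edge X -> unitary B) : Prop :=
  [/\ forall e, uval (u (bar e)) = star (uval (u e)),
      forall e b, uval (u (bar e)) * f (src e) (gs GG e b) * uval (u e) =
                  f (rng e) (gr b)
    & forall e, sub_edge T e -> uval (u e) = 1].

Record fundamental (R : realType) (X : sgraph) (GG : cqg_graph R X)
    (T : subgraph X) (G : cqg R) := Fundamental {
  pi_v : forall q, {shom gv GG q -> G};
  pi_u : edge X -> unitary G;
  pi_rel : fundamental_rel T pi_v pi_u;
  pi_univ : forall (B : cstarType R) (f : forall q, {shom gv GG q -> B})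
      (v : edge X -> unitary B),
    fundamental_rel T f v ->
    unique_shom (fun phi : {shom G -> B} =>
      (forall q a, phi (pi_v q a) = f q a) /\
      (forall e, phi (uval (pi_u e)) = uval (v e)));
  pi_D_v : forall q, intertwines (pi_v q);
  pi_D_u : forall e,
    cqg_D G (uval (pi_u e)) =
    tpair (cqg_t G) (uval (pi_u e)) (uval (pi_u e))
}.

Definition loop_group (R : realType) (X : sgraph) (GG : cqg_graph R X)
    (T : subgraph X) (G : cqg R) (p : fundamental GG T G) : groupType :=
  subgroup_gen (range (pi_u p)).

Definition loop_val (R : realType) (X : sgraph) (GG : cqg_graph R X)
    (T : subgraph X) (G : cqg R) (p : fundamental GG T G)
    (g : loop_group p) : G := uval (sgval_gen g).

(* [GN] is the graph of the free wreath products of the quantum groups of [GG],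
   with structure maps s_e^N.  The fields [wg_bar_*] say that the equality
   [ge GN (bar e) = ge GN e] identifies the two as free wreath products of the
   same quantum group. *)
Record wreath_graph (R : realType) N (S : cqg R) (qp : quantum_perm N S)
    (X : sgraph) (GG GN : cqg_graph R X) := WreathGraph {
  wg_v : forall q, free_wreath qp (gv GG q) (gv GN q);
  wg_e : forall e, free_wreath qp (ge GG e) (ge GN e);
  wg_bar_nu : forall e i (b : ge GG (bar e)),
    cqg_cast (ge_bar GN e) (wr_nu (wg_e (bar e)) i b) =
    wr_nu (wg_e e) i (cqg_cast (ge_bar GG e) b);
  wg_bar_perm : forall e (x : S),
    cqg_cast (ge_bar GN e) (wr_perm (wg_e (bar e)) x) = wr_perm (wg_e e) x;
  wg_s_nu : forall e i (b : ge GG e),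
    gs GN e (wr_nu (wg_e e) i b) = wr_nu (wg_v (src e)) i (gs GG e b);
  wg_s_perm : forall e (x : S),
    gs GN e (wr_perm (wg_e e) x) = wr_perm (wg_v (src e)) x
}.

(* Main.v *)
Require Import Defs.
From HB Require Import structures.
From mathcomp Require Import all_boot all_order all_algebra.
From mathcomp Require Import complex ring lra.
From mathcomp Require Import all_classical all_reals all_analysis.

Set Implicit Arguments.
Unset Strict Implicit.
Unset Printing Implicit Defensive.

Import Order.TTheory GRing.Theory Num.Theory numFieldNormedType.Exports.

Local Open Scope classical_set_scope.
Local Open Scope ring_scope.

(* Both algebras are generated by N copies of the C(G_q), a copy of C(S_N^+) and
   unitaries u_e, so mutually inverse *-homomorphisms come from the universal
   properties.  Two points need an argument.  In the fundamental quantum group of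
   the wreath products the copies of C(S_N^+) at the two ends of an edge are
   conjugate by u_e; since u_e = 1 on the tree and the tree spans, there is only
   one such copy, and then every u_e commutes with it.  In the wreath product
   the u_e lie in the amalgamated C^*(Gamma), so they do not depend on the copy
   of C(G), and for the same reason they commute with all the u_ij.

   The ideal defining the wreath product is closed, so *-homomorphisms are needed
   to be contractive; this is obtained without spectral theory, from the fact that a
   self-adjoint element of norm < 1 is the real part of a unitary. *)

(** * Norms and square roots *)

Section CNorm.
Context (R : realType) (A : cstarType R).
Implicit Types x y z : A.

Lemma cnorm0 : cnorm (0 : A) = 0.
Proof.
apply: complexI; rewrite -(scale0r (0 : A)) cnormZ.
by rewrite normr0 mul0r.
Qed.

Lemma cnormN x : cnorm (- x) = cnorm x.
Proof. by apply: complexI; rewrite -scaleN1r cnormZ normrN1 mul1r. Qed.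

Lemma cnorm_ge0 x : 0 <= cnorm x.
Proof.
have := ler_cnormD x (- x).
by rewrite subrr cnorm0 cnormN -mulr2n pmulrn_lge0.
Qed.

Lemma cnormZr (r : R) x : 0 <= r -> cnorm (r%:C%C *: x) = r * cnorm x.
Proof.
move=> r0; apply: complexI; rewrite cnormZ rmorphM /=.
by congr (_ * _); rewrite ger0_norm // lecR.
Qed.

Lemma cnormB x y : cnorm (x - y) = cnorm (y - x).
Proof. by rewrite -cnormN opprB. Qed.

Lemma ler_cnormB x y : cnorm (x - y) <= cnorm x + cnorm y.
Proof. by rewrite (le_trans (ler_cnormD _ _))// cnormN. Qed.

Lemma cnorm_dist x y z : cnorm (x - z) <= cnorm (x - y) + cnorm (y - z).
Proof. by rewrite (le_trans _ (ler_cnormD _ _))// addrA subrK. Qed.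

Lemma cnorm_star x : cnorm (star x) = cnorm x.
Proof.
suff le_star y : cnorm y <= cnorm (star y).
  by apply/eqP; rewrite eq_le le_star andbT -{2}[x]starK le_star.
have := cnorm_ge0 y; rewrite le_eqVlt => /predU1P[<-|y0]; first exact: cnorm_ge0.
by rewrite -(ler_pM2r y0) -expr2 -cstar_identity ler_cnormM.
Qed.

Lemma star0 : star (0 : A) = 0.
Proof. by apply: (@addIr _ (star 0)); rewrite -starD !add0r. Qed.

Lemma starN x : star (- x) = - star x.
Proof. by rewrite -scaleN1r starZ rmorphN1 scaleN1r. Qed.

Lemma starB x y : star (x - y) = star x - star y.
Proof. by rewrite starD starN. Qed.

Lemma cnorm1 : cnorm (1 : A) = 1.
Proof.
have := cstar_identity (1 : A); rewrite star1 mulr1 expr2 => /esym n11.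
apply: (@mulfI _ (cnorm (1 : A))); last by rewrite mulr1.
by apply/eqP => /cnorm_eq0/eqP; rewrite oner_eq0.
Qed.

(** Limiting arguments end here: [K] collects the errors of size [e] that the triangle inequality
    adds up. *)
Lemma cnorm_eps (K : R) x : (forall e, 0 < e -> cnorm x <= K * e) -> x = 0.
Proof.
move=> xe; apply: cnorm_eq0; apply/eqP; rewrite eq_le cnorm_ge0 andbT.
apply/ler_addgt0Pr => e e0; rewrite add0r.
have K0 : 0 < `|K| + 1 by rewrite ltr_wpDl.
apply: (le_trans (xe (e / (`|K| + 1)) _)); first exact: divr_gt0.
rewrite mulrA ler_pdivrMr// [leRHS]mulrC ler_pM2r//.
by rewrite (le_trans (ler_norm _))// lerDl.
Qed.

Lemma cauchy_cvg (u : nat -> A) :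
  (forall e, 0 < e -> exists n0, forall m n, (n0 <= m)%N -> (n0 <= n)%N ->
     cnorm (u m - u n) < e) ->
  exists l, forall e, 0 < e -> exists n0, forall n, (n0 <= n)%N ->
    cnorm (u n - l) < e.
Proof.
move=> /cnorm_complete[l ul]; exists l => e e0.
have /cvgrPdist_lt/(_ e e0)[n0 _ un0] := ul.
exists n0 => n nn0; have := un0 n nn0.
by rewrite /= sub0r normrN ger0_norm// cnorm_ge0.
Qed.

Lemma expr_small (q e : R) : 0 <= q < 1 -> 0 < e -> exists n, q ^+ n < e.
Proof.
move=> /andP[q0 q1] e0.
have /cvgrPdist_lt/(_ e e0)[n0 _ un0] : q ^+ n @[n --> \oo] --> (0 : R).
  by apply: cvg_expr; rewrite ger0_norm.
exists n0; have := un0 n0 (leqnn _).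
by rewrite /= sub0r normrN ger0_norm// exprn_ge0.
Qed.

Lemma star_half x : star (2^-1%:C%C *: x) = 2^-1%:C%C *: star x.
Proof. by rewrite starZ; congr (_ *: _); exact: conjc_real. Qed.

Lemma halfD x : 2^-1%:C%C *: x + 2^-1%:C%C *: x = x.
Proof.
rewrite -scalerDl -rmorphD/= (_ : 2^-1 + 2^-1 = 1 :> R) ?scale1r//.
by field.
Qed.

(* The square root is [1 - l], where [l] is the fixed point of the contraction
   [y |-> (c + y ^ 2) / 2] of the ball of radius [cnorm c]. *)
Lemma cstar_sqrt1B (c : A) : star c = c -> cnorm c < 1 ->
  exists b : A, [/\ star b = b, b * b = 1 - c
    & forall x, x * c = c * x -> x * b = b * x].
Proof.
move=> cs c1; pose q := cnorm c; have q0 : 0 <= q := cnorm_ge0 c.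
pose g (y : A) := 2^-1%:C%C *: (c + y * y).
have h0 : (0 : R) <= 2^-1 by rewrite invr_ge0.
(* [x ^ 2 - y ^ 2 = x (x - y) + (x - y) y], and the factor 1/2 in [g] offsets the two terms: [g] is
   [q]-Lipschitz on the ball of radius [q]. *)
have gB (x y : A) : cnorm x <= q -> cnorm y <= q ->
    cnorm (g x - g y) <= q * cnorm (x - y).
  move=> xq yq; rewrite /g -scalerBr cnormZr// opprD addrACA subrr add0r.
  have -> : x * x - y * y = x * (x - y) + (x - y) * y.
    by rewrite mulrBr mulrBl addrA subrK.
  have := ler_cnormD (x * (x - y)) ((x - y) * y).
  have := ler_cnormM x (x - y); have := ler_cnormM (x - y) y.
  have := ler_wpM2r (cnorm_ge0 (x - y)) xq.
  have := ler_wpM2l (cnorm_ge0 (x - y)) yq.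
  by lra.
have gq (y : A) : cnorm y <= q -> cnorm (g y) <= q.
  move=> yq; rewrite /g cnormZr//.
  have := ler_cnormD c (y * y); have := ler_cnormM y y.
  have := cnorm_ge0 y; rewrite -/q; move: c1; rewrite -/q; nra.
pose u n := iter n g 0.
have uq n : cnorm (u n) <= q.
  by elim: n => [|n IHn]; rewrite /u ?cnorm0//= gq.
have uS n k : cnorm (u (n + k)%N - u n) <= q ^+ n.
  elim: n => [|n IHn].
    by rewrite add0n /= subr0 (le_trans (uq k))// ltW.
  rewrite exprS addSn /=; apply: (le_trans (gB _ _ (uq _) (uq _))).
  exact: ler_wpM2l.
have [l ul] : exists l, forall e, 0 < e -> exists n0, forall n, (n0 <= n)%N ->
    cnorm (u n - l) < e.
  apply: cauchy_cvg => e e0.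
  have q01 : 0 <= q < 1 by rewrite q0.
  have [|n0 qe] := @expr_small q (e / 2) q01; first by rewrite divr_gt0.
  exists n0 => m n /subnKC <- /subnKC <-.
  have := cnorm_dist (u (n0 + (m - n0))%N) (u n0) (u (n0 + (n - n0))%N).
  rewrite (cnormB (u n0)); have := uS n0 (m - n0)%N; have := uS n0 (n - n0)%N.
  by lra.
have lq : cnorm l <= q.
  apply/ler_addgt0Pr => e e0; have [n0 /(_ _ (leqnn _))] := ul e e0.
  have := cnorm_dist l (u n0) 0; rewrite !subr0 (cnormB l); have := uq n0.
  by lra.
have us n : star (u n) = u n.
  elim: n => [|n IHn]; first exact: star0.
  by rewrite /u /= -/(u n) /g star_half starD starM IHn cs.
have ls : star l = l.
  apply/eqP; rewrite -subr_eq0; apply/eqP/(@cnorm_eps 2) => e e0.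
  have [n0 /(_ _ (leqnn _)) une] := ul e e0.
  have := cnorm_dist (star l) (u n0) l.
  rewrite -{1}us -starB cnorm_star (cnormB l); lra.
have lg : l = g l.
  apply/eqP; rewrite -subr_eq0; apply/eqP/(@cnorm_eps 2) => e e0.
  have [n0 une] := ul e e0.
  have := cnorm_dist l (u n0.+1) (g l); rewrite (cnormB l (u _)).
  rewrite -[u n0.+1]/(g (u n0)).
  have := ler_wpM2r (cnorm_ge0 (u n0 - l)) (ltW c1); rewrite mul1r -/q.
  have := gB _ _ (uq n0) lq; have := une n0.+1 (leqnSn _).
  rewrite -[u n0.+1]/(g (u n0)).
  by have := une n0 (leqnn _); lra.
(* The fixed point equation [2 l = c + l ^ 2] says [(1 - l) ^ 2 = 1 - c]. What commutes with [c]
   commutes with every iterate, hence with [l]. *)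
exists (1 - l); split.
- by rewrite starB star1 ls.
- have ll : l + l = c + l * l by rewrite {1 2}lg /g halfD.
  have -> : c = l + l - l * l by rewrite ll addrK.
  by rewrite mulrBl !mulrBr !mulr1 !mul1r !opprD !opprK !addrA.
- move=> x xc; rewrite mulrBr mulrBl mulr1 mul1r; congr (_ - _).
  have xu n : x * u n = u n * x.
    elim: n => [|n IHn]; first by rewrite mulr0 mul0r.
    rewrite /u /= -/(u n) /g -scalerAr -scalerAl mulrDr mulrDl xc.
    by rewrite mulrA IHn -mulrA IHn mulrA.
  apply/eqP; rewrite -subr_eq0; apply/eqP.
  apply: (@cnorm_eps (2 * cnorm x)) => e e0.
  have [n0 /(_ _ (leqnn _)) une] := ul e e0.
  have -> : x * l - l * x = (u n0 - l) * x - x * (u n0 - l).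
    by rewrite mulrBl mulrBr xu opprB [RHS]addrC addrA subrK.
  have := ler_cnormB ((u n0 - l) * x) (x * (u n0 - l)).
  have := ler_cnormM x (u n0 - l); have := ler_cnormM (u n0 - l) x.
  have := cnorm_ge0 x; nra.
Qed.
End CNorm.

(** * Contractivity of *-homomorphisms *)

Lemma shom_of (R : realType) (A B : cstarType R) (f : A -> B) :
  linear f -> f 1 = 1 -> {morph f : x y / x * y} ->
  (forall x, f (star x) = star (f x)) -> exists phi : {shom A -> B}, phi =1 f.
Proof.
move=> fL f1 fM fS.
pose phi : {shom A -> B} := HB.pack f (GRing.isLinear.Build _ _ _ _ f fL)
  (GRing.isMonoidMorphism.Build _ _ f (conj f1 fM)) (isStarMap.Build R A B f fS).
by exists phi.
Qed.
Section StarHomTheory.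
Context (R : realType) (A B : cstarType R).

(* A self-adjoint [a] of norm [< 1] is the real part of the unitary
   [a + 'i * sqrt (1 - a ^ 2)], hence so is its image. *)
Lemma cnorm_shom_sa (f : {shom A -> B}) (a : A) :
  star a = a -> cnorm a < 1 -> cnorm (f a) <= 1.
Proof.
move=> sa a1; have [||b [sb bb bc]] := @cstar_sqrt1B _ _ (a * a).
- by rewrite starM sa.
- have := ler_cnormM a a; have := cnorm_ge0 a; nra.
have ab : a * b = b * a by apply: bc; rewrite mulrA.
have si : ('i : R[i])^* = - 'i by exact: conjCi.
pose u := a + 'i *: b.
have su : star u = a - 'i *: b by rewrite /u starD starZ sa sb si scaleNr.
have uu : star u * u = 1.
  rewrite su /u mulrDr !mulrBl -!scalerAl -!scalerAr scalerA -(expr2 'i) sqrCi.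
  by rewrite scaleN1r opprK ab bb addrA subrK addrC subrK.
have nu : cnorm (f u) = 1.
  have := cstar_identity (f u); rewrite -star_map -rmorphM uu rmorph1 cnorm1.
  move/esym/eqP; rewrite sqrf_eq1 => /orP[/eqP//|/eqP n1].
  by have := cnorm_ge0 (f u); rewrite n1 oppr_ge0 ler10.
have -> : a = 2^-1%:C%C *: u + 2^-1%:C%C *: star u.
  by rewrite -scalerDr su /u addrACA subrr addr0 scalerDr halfD.
have h0 : (0 : R) <= 2^-1 by rewrite invr_ge0.
rewrite rmorphD/= !linearZ/= star_map (le_trans (ler_cnormD _ _))//.
rewrite !cnormZr// cnorm_star nu; lra.
Qed.

(** By the C*-identity it is enough to treat [a = star x * x]. Dividing by [cnorm a + e] makes the
    norm less than 1, and [e] is arbitrary. *)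
Lemma cnorm_shom (f : {shom A -> B}) x : cnorm (f x) <= cnorm x.
Proof.
suff sq : cnorm (f x) ^+ 2 <= cnorm x ^+ 2.
  by rewrite -(@ler_pXn2r _ 2)// nnegrE cnorm_ge0.
rewrite -!cstar_identity -star_map -rmorphM; set a := star x * x.
have sa : star a = a by rewrite /a starM starK.
apply/ler_addgt0Pr => e e0.
pose k := cnorm a + e; have k0 : 0 < k by rewrite ltr_wpDl// cnorm_ge0.
have kV : 0 <= k^-1 by rewrite invr_ge0 ltW.
have := @cnorm_shom_sa f (k^-1%:C%C *: a).
rewrite starZ sa (_ : _^* = k^-1%:C%C); last exact: conjc_real.
rewrite linearZ/= !cnormZr// mulrC ltr_pdivrMr// mul1r => /(_ erefl).
rewrite mulrC ler_pdivrMr// mul1r; apply.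
by rewrite ltrDl.
Qed.

(** Closedness comes from contractivity; hence a homomorphism that kills the relators kills the
    closed ideal they generate. *)
Lemma shom_ker_closed (f : {shom A -> B}) : closed_ideal [set x | f x = 0].
Proof.
split=> [x xc|/=|x y /= fx fy|a x b /= fx].
- apply: (@cnorm_eps _ _ 1) => e e0; have [y /= fy xy] := xc e e0.
  rewrite mul1r (le_trans _ (ltW xy))// -[f x]subr0 -fy -rmorphB.
  exact: cnorm_shom.
- exact: rmorph0.
- by rewrite rmorphD/= fx fy addr0.
- by rewrite !rmorphM/= fx mulr0 mul0r.
Qed.

Lemma eq_shom_dense (f g : {shom A -> B}) (X : set A) :
  cclosure (lspan X) = setT -> (forall x, X x -> f x = g x) -> f =1 g.
Proof.
move=> Xd fg x; have xc : cclosure (lspan X) x by rewrite Xd.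
apply/eqP; rewrite -subr_eq0; apply/eqP/(@cnorm_eps _ _ 2) => e e0.
have [y [n [c [a [Xa ->{y}]]]] xy] := xc e e0.
set y := \sum_(i < n) _ in xy.
have fgy : f y = g y.
  by rewrite !rmorph_sum; apply: eq_bigr => i _ /=; rewrite !linearZ/= fg.
have := cnorm_dist (f x) (f y) (g x); rewrite {2}fgy -!rmorphB.
have := cnorm_shom f (x - y); have := cnorm_shom g (y - x).
by rewrite (cnormB y x); lra.
Qed.

(** The factor is [f] composed with a set-theoretic section of [p]; it is a homomorphism because [f]
    is constant on the fibres of [p]. *)
Lemma quotient_factor (I : set A) (Q : cstarType R) (p : cstar_quotient I Q)
  (f : {shom A -> B}) : (forall x, I x -> f x = 0) ->
  exists phi : {shom Q -> B}, forall x, phi (p x) = f x.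
Proof.
move=> If; have [s ps] := choice (cq_surj p).
have fE x y : p x = p y -> f x = f y.
  move=> /eqP; rewrite -subr_eq0 -rmorphB => /eqP/(cq_ker p)/If/eqP.
  by rewrite rmorphB subr_eq0 => /eqP.
have [||||phi phiE] := @shom_of _ Q B (f \o s).
- move=> c x y /=; rewrite -[in RHS]linearZ -rmorphD; apply: fE.
  by rewrite rmorphD/= linearZ/= !ps.
- by rewrite /= -(rmorph1 f); apply: fE; rewrite ps rmorph1.
- by move=> x y /=; rewrite -rmorphM; apply: fE; rewrite rmorphM/= !ps.
- by move=> x /=; rewrite -star_map; apply: fE; rewrite star_map !ps.
by exists phi => x; rewrite phiE; apply: fE; rewrite ps.
Qed.
End StarHomTheory.

(** * Minimal tensor products of isomorphisms *)

Lemma mul_approx (R : realType) (A : cstarType R) (x y : A) (e : R) : 0 < e ->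
  exists2 d : R, 0 < d & forall x' y', cnorm (x - x') < d -> cnorm (y - y') < d ->
    cnorm (x * y - x' * y') < e.
Proof.
move=> e0; pose k := cnorm x + cnorm y + 1.
have k0 : 0 < k by rewrite ltr_wpDl// addr_ge0// cnorm_ge0.
exists (Num.min 1 (e / k)) => [|x' y'].
  by rewrite lt_min ltr01 divr_gt0.
rewrite !lt_min !ltr_pdivlMr// => /andP[x1 xk] /andP[y1 yk].
have -> : x * y - x' * y' = x * (y - y') + (x - x') * y'.
  by rewrite mulrBr mulrBl addrA subrK.
have y'1 : cnorm y' <= cnorm y + 1.
  have := cnorm_dist y' y 0; rewrite !subr0 (cnormB y'); lra.
have := ler_cnormD (x * (y - y')) ((x - x') * y').
have := ler_cnormM x (y - y'); have := ler_cnormM (x - x') y'.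
have := cnorm_ge0 x; have := cnorm_ge0 y; have := cnorm_ge0 (x - x').
have := cnorm_ge0 (y - y').
pose p := cnorm (x - x'); pose q := cnorm (y - y'); rewrite -/p -/q in xk yk *.
move=> q0 p0 yn xn h1 h2 h3.
have := ler_wpM2l p0 y'1; move: xk yk; rewrite /k.
have [pq|/ltW qp] := leP p q; last first.
- by have := ler_wpM2l xn qp; nra.
- by have := ler_wpM2r (addr_ge0 yn ler01) pq; nra.
Qed.

(** * Extending a densely defined contractive relation *)

Section Extension.
Context (R : realType) (A B : cstarType R) (D : A -> B -> Prop).
Hypothesis D_le : forall x y, D x y -> cnorm y <= cnorm x.
Hypothesis D_1 : D 1 1.
Hypothesis D_D : forall x y x' y', D x y -> D x' y' -> D (x + x') (y + y').
Hypothesis D_Z : forall (c : R[i]) x y, D x y -> D (c *: x) (c *: y).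
Hypothesis D_M : forall x y x' y', D x y -> D x' y' -> D (x * x') (y * y').
Hypothesis D_star : forall x y, D x y -> D (star x) (star y).
Hypothesis D_dense : forall x (e : R), 0 < e ->
  exists x' y', D x' y' /\ cnorm (x - x') < e.

(** The closure of the graph [D]. A relation is extended because an element of a tensor product has
    many expressions as a sum of elementary tensors. *)
Let E (x : A) (y : B) := forall e : R, 0 < e ->
  exists x' y', [/\ D x' y', cnorm (x - x') < e & cnorm (y - y') < e].

Let DE x y : D x y -> E x y.
Proof. by move=> Dxy e e0; exists x, y; rewrite !subrr !cnorm0. Qed.

Let D_dist x y x' y' : D x y -> D x' y' -> cnorm (y - y') <= cnorm (x - x').
Proof.
by move=> xy /(D_Z (- 1)) /(D_D xy) /D_le; rewrite !scaleN1r.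
Qed.

Let E_uniq x y y' : E x y -> E x y' -> y = y'.
Proof.
move=> Ey Ey'; apply/eqP; rewrite -subr_eq0; apply/eqP/(@cnorm_eps _ _ 4) => e e0.
have [x1 [y1 [D1 xx1 yy1]]] := Ey e e0; have [x2 [y2 [D2 xx2 yy2]]] := Ey' e e0.
have := cnorm_dist y y1 y'; have := cnorm_dist y1 y2 y'; have := D_dist D1 D2.
have := cnorm_dist x1 x x2; rewrite (cnormB x1 x) (cnormB y2 y'); lra.
Qed.

Let E_total x : exists y, E x y.
Proof.
have /choice[u uP] n : exists p : A * B, D p.1 p.2 /\ cnorm (x - p.1) < n.+1%:R^-1.
  have n0 : (0 : R) < n.+1%:R^-1 by rewrite invr_gt0.
  by have [x' [y' ?]] := D_dense x n0; exists (x', y').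
have small (e : R) : 0 < e ->
    exists n0, forall n, (n0 <= n)%N -> cnorm (x - (u n).1) < e.
  move=> e0; exists (Num.truncn e^-1) => n nn.
  apply: (lt_trans (uP n).2); rewrite invf_plt ?posrE//.
  apply: (lt_le_trans (truncnS_gt _)).
  by rewrite ler_nat.
have [|l ul] := @cauchy_cvg _ _ (fun n => (u n).2).
  move=> e e0; have [|n0 h] := small (e / 2); first by rewrite divr_gt0.
  exists n0 => m n /h xm /h xn.
  have := D_dist (uP m).1 (uP n).1; have := cnorm_dist (u m).1 x (u n).1.
  by rewrite (cnormB (u m).1 x); lra.
exists l => e e0; have [n1 h1] := ul e e0; have [n2 h2] := small e e0.
exists (u (maxn n1 n2)).1, (u (maxn n1 n2)).2; split.
- exact: (uP _).1.
- by apply: h2; exact: leq_maxr.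
- by rewrite cnormB; apply: h1; exact: leq_maxl.
Qed.

Let E_D x y x' y' : E x y -> E x' y' -> E (x + x') (y + y').
Proof.
move=> Ex Ex' e e0; have e2 : 0 < e / 2 by rewrite divr_gt0.
have [x1 [y1 [D1 xx1 yy1]]] := Ex _ e2; have [x2 [y2 [D2 xx2 yy2]]] := Ex' _ e2.
exists (x1 + x2), (y1 + y2); split; first exact: D_D.
- by have := ler_cnormD (x - x1) (x' - x2); rewrite opprD addrACA; lra.
- by have := ler_cnormD (y - y1) (y' - y2); rewrite opprD addrACA; lra.
Qed.

Let E_M x y x' y' : E x y -> E x' y' -> E (x * x') (y * y').
Proof.
move=> Ex Ex' e e0; have [d1 d10 h1] := mul_approx x x' e0.
have [d2 d20 h2] := mul_approx y y' e0.
have d0 : 0 < Num.min d1 d2 by rewrite lt_min d10.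
have [x1 [y1 [D1]]] := Ex _ d0; have [x2 [y2 [D2]]] := Ex' _ d0.
rewrite !lt_min => /andP[? ?] /andP[? ?] /andP[? ?] /andP[? ?].
by exists (x1 * x2), (y1 * y2); split; [exact: D_M|exact: h1|exact: h2].
Qed.

Let E_star x y : E x y -> E (star x) (star y).
Proof.
move=> Ex e e0; have [x1 [y1 [D1 xx1 yy1]]] := Ex _ e0.
exists (star x1), (star y1); split; first exact: D_star.
- by rewrite -starB cnorm_star.
- by rewrite -starB cnorm_star.
Qed.

(** The closure [E] is a function: single valued by [D_le], total by density and completeness of
    [B]. The operations pass to it by continuity. *)
Lemma shom_extension : exists h : {shom A -> B}, forall x y, D x y -> h x = y.
Proof.
have [h hE] := choice E_total.
have hP x y : E x y -> h x = y by exact: E_uniq.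
have [||||phi phiE] := @shom_of _ _ _ h; last first.
- by exists phi => x y Dxy; rewrite phiE; exact/hP/DE.
- by move=> x; exact/hP/E_star.
- by move=> x y; exact/hP/E_M.
- exact/hP/DE.
- move=> c x y; apply/hP/E_D => //.
  (* Scaling by [c] is multiplication by [c *: 1], so linearity follows from sums and products. *)
  have := E_M (DE (D_Z c D_1)) (hE x).
  by rewrite -!scalerAl !mul1r.
Qed.
End Extension.

Section TensorIso.
Context (R : realType).

Lemma shom_inverse (A B : cstarType R) (f : {shom A -> B}) : bijective f ->
  exists g : {shom B -> A}, cancel f g /\ cancel g f.
Proof.
move=> [g fK gK]; have fI := can_inj fK.
have [||||phi phiE] := @shom_of _ _ _ g; last first.
- by exists phi; split=> x; rewrite phiE.
- by move=> x; apply: fI; rewrite star_map !gK.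
- by move=> x y; apply: fI; rewrite rmorphM/= !gK.
- by apply: fI; rewrite gK rmorph1.
- by move=> c x y; apply: fI; rewrite linearP/= !gK.
Qed.

Lemma tensor_eq_shom (A B T C : cstarType R) (t : cstar_tensor A B T)
    (f g : {shom T -> C}) : (forall a, f (tl t a) = g (tl t a)) ->
  (forall b, f (tr t b) = g (tr t b)) -> f =1 g.
Proof.
move=> fl fr; apply: (eq_shom_dense (tdense t)) => x [a [b ->]].
by rewrite !rmorphM/= fl fr.
Qed.

Context (A B T A' B' T' : cstarType R).

(** Composed with [f] and [g], the legs of [t'] make [T'] a C*-tensor product of [A] and [B], and
    the norm of [t] is the least such. Surjectivity gives density, injectivity gives [tinj]. *)
Lemma min_tensor_le (t : min_tensor A B T) (t' : cstar_tensor A' B' T')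
    (f : {shom A -> A'}) (g : {shom B -> B'}) n (a : 'I_n -> A) (b : 'I_n -> B) :
  bijective f -> bijective g ->
  cnorm (\sum_i tpair t (a i) (b i)) <= cnorm (\sum_i tpair t' (f (a i)) (g (b i))).
Proof.
move=> [f' fK f'K] [g' gK g'K].
pose l := scomp (tl t') f; pose r := scomp (tr t') g.
have lrC x y : l x * r y = r y * l x by exact: tcomm.
have lr_dense : cclosure (lspan [set z | exists x y, z = l x * r y]) = setT.
  rewrite -(tdense t'); congr (cclosure (lspan _)).
  apply/seteqP; split=> z /= [x [y ->]]; first by exists (f x), (g y).
  by exists (f' x), (g' y); rewrite /= f'K g'K.
have lr_inj m (x : 'I_m -> A) (y : 'I_m -> B) :
    (forall c : 'I_m -> R[i],
       \sum_(i < m) c i *: x i = 0 -> forall i, c i = 0) ->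
    \sum_(i < m) l (x i) * r (y i) = 0 -> forall i, y i = 0.
  move=> xfree xy0 i; apply: (can_inj gK); rewrite rmorph0.
  apply: (@tinj _ _ _ _ t' m (f \o x) (g \o y)) => // c.
  rewrite /= => cx0; apply: xfree; apply: (can_inj fK).
  rewrite rmorph0 -[RHS]cx0 rmorph_sum; apply: eq_bigr => j _.
  by rewrite /= linearZ.
exact: (mt_min t (CStarTensor lrC lr_dense lr_inj)).
Qed.
End TensorIso.

(** [min_tensor_le] for the inverse maps shows that applying [f] and [g] to the legs does not
    increase the norm of a sum of elementary tensors; density then extends the map. *)
Lemma tensor_iso_hom (R : realType) (A B T A' B' T' : cstarType R)
    (t : min_tensor A B T) (t' : min_tensor A' B' T')
    (f : {shom A -> A'}) (g : {shom B -> B'}) :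
  bijective f -> bijective g ->
  exists h : {shom T -> T'}, is_tensor_hom t t' f g h.
Proof.
move=> fb gb.
pose s1 (s : seq (A * B)) := \sum_(p <- s) tpair t p.1 p.2.
pose s2 (s : seq (A * B)) := \sum_(p <- s) tpair t' (f p.1) (g p.2).
have s21 s : cnorm (s2 s) <= cnorm (s1 s).
  have [f' [fK f'K]] := shom_inverse fb; have [g' [gK g'K]] := shom_inverse gb.
  have f'b : bijective f' by exists f.
  have g'b : bijective g' by exists g.
  have := @min_tensor_le _ _ _ _ _ _ _ t' t f' g' (size s)
    (fun i => f (nth (0, 0) s i).1) (fun i => g (nth (0, 0) s i).2) f'b g'b.
  rewrite /s1 /s2 !(big_nth (0, 0)) !big_mkord.
  by under [in leRHS]eq_bigr do rewrite fK gK.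
pose D (x : T) (y : T') := exists s, x = s1 s /\ y = s2 s.
have DM (x : T) (y : T') (x' : T) (y' : T') : D x y -> D x' y' -> D (x * x') (y * y').
  move=> [s [-> ->]] [s' [-> ->]].
  exists [seq (p.1 * q.1, p.2 * q.2) | p <- s, q <- s'].
  rewrite /s1 /s2 !big_allpairs_dep/= !mulr_suml.
  by split; apply: eq_bigr => p _; rewrite mulr_sumr; apply: eq_bigr => q _;
    rewrite /tpair !rmorphM/= !mulrA -(mulrA (tl _ _) (tr _ _)) -tcomm !mulrA.
have Dl a : D (tl t a) (tl t' (f a)).
  by exists [:: (a, 1)]; rewrite /s1 /s2 !big_seq1 /tpair/= !rmorph1 !mulr1.
have Dr b : D (tr t b) (tr t' (g b)).
  by exists [:: (1, b)]; rewrite /s1 /s2 !big_seq1 /tpair/= !rmorph1 !mul1r.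
have DD (x : T) (y : T') (x' : T) (y' : T') : D x y -> D x' y' -> D (x + x') (y + y').
  by move=> [s [-> ->]] [s' [-> ->]]; exists (s ++ s'); rewrite /s1 /s2 !big_cat.
have D1 : D 1 1 by have := Dl 1; rewrite !rmorph1.
have DZ (c : R[i]) (x : T) (y : T') : D x y -> D (c *: x) (c *: y).
  move=> xy; rewrite -(mul1r x) -(mul1r y) !scalerAl; apply: DM => //.
  by have := Dl (c *: 1); rewrite !linearZ/= !rmorph1.
have D0 : D 0 0 by exists [::]; rewrite /s1 /s2 !big_nil.
have [|||||||h hP] := @shom_extension _ _ _ D => //.
- by move=> x y [s [-> ->]].
- move=> x y [s [-> ->]]; exists [seq (star p.1, star p.2) | p <- s].
  rewrite /s1 /s2 !big_map/= !(big_morph _ (@starD _ _) (@star0 _ _)).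
  split; apply: eq_bigr => p _; rewrite /tpair starM -!star_map tcomm//.
- move=> x e e0; have : cclosure (lspan [set x | exists a b, x = tl t a * tr t b]) x.
    by rewrite tdense.
  move=> /(_ e e0)[y [n [c [a [aP ->]]]] xy].
  suff [y' ?] : exists y', D (\sum_(i < n) c i *: a i) y'.
    by exists (\sum_(i < n) c i *: a i), y'.
  elim/big_ind: _ => [|z z' [y1 ?] [y2 ?]|i _]; first by exists 0.
    by exists (y1 + y2); exact: DD.
  have [a' [b' ->]] := aP i; eexists; apply: DZ; exact: DM.
by exists h; split=> [a|b]; exact: hP.
Qed.

(** * Spanning trees *)

Section SpanningTree.
Context (X : sgraph).
Implicit Types (x y z : vert X) (e f : edge X) (p : seq (edge X)) (T : subgraph X).

Lemma walk_exit (V : set (vert X)) p x y : walk x p y -> V x -> ~ V y ->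
  exists e, V (src e) /\ ~ V (rng e).
Proof.
elim: p x => [x -> //|e p IHp x [<- ep] Vx Vy].
by have [/(IHp _ ep)|] := pselect (V (rng e)); [exact|exists e].
Qed.

Lemma walk_rcons p e x y :
  walk x (rcons p e) y -> walk x p (src e) /\ rng e = y.
Proof.
elim: p x => [x /= [-> ->] //|f p IHp x /= [xf /IHp[pe ey]]].
by split.
Qed.

Lemma all_in_rcons (E : set (edge X)) p e :
  all_in E (rcons p e) -> all_in E p /\ E e.
Proof.
elim: p => [[]//|f p IHp /= [Ef /IHp[Ep Ee]]].
by split.
Qed.

Lemma reduced_behead p e : reduced (e :: p) -> reduced p.
Proof. by move=> re p1 f p2 pE; apply: (re (e :: p1) f p2); rewrite pE. Qed.

Lemma reduced_rcons p e : reduced (rcons p e) -> reduced p.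
Proof.
by move=> re p1 f p2 pE; apply: (re p1 f (rcons p2 e)); rewrite pE rcons_cat.
Qed.

(* Otherwise an edge leaving the tree can be added to it: in the larger graph the
   new vertex is a leaf, so a reduced closed walk avoids the new edge. *)
Lemma maximal_subtree_spans T x :
  connected_graph X -> maximal_subtree T -> sub_vert T x.
Proof.
move=> [_ conn] [[[x0 Tx0] Tconn Tred] Tmax]; apply: contrapT => nTx.
have [p0 wp0] := conn x0 x.
have [e [Te nTe]] := walk_exit wp0 Tx0 nTx.
pose V := sub_vert T `|` [set rng e].
pose E := sub_edge T `|` [set f | f = e \/ f = bar e].
have Esrc f : E f -> V (src f).
  by case=> [/sub_src|[->|->]]; [left|left|right].
have Ebar f : E f -> E (bar f).
  by case=> [/sub_bar|[->|->]]; [left|right; right|right; left; rewrite barK].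
pose T' := Subgraph Esrc Ebar.
(* In the enlarged graph [rng e] is a leaf: only [bar e] leaves it, and only [e] enters it. *)
have srcE f : E f -> src f = rng e -> f = bar e.
  move=> [/sub_src Tf|[->|->]] // fe; first by rewrite fe in Tf.
  by rewrite fe in Te.
have rngE f : E f -> rng f = rng e -> f = e.
  by move=> /Ebar/srcE /[apply] fe; rewrite -[f]barK fe barK.
have TE p : all_in (sub_edge T) p -> all_in E p.
  by elim: p => //= f p IHp [Tf /IHp Ep]; split=> //; left.
(* A walk that reaches the leaf by [e] and goes on must return by [bar e], so it is not reduced. *)
have old p x1 z : all_in E p -> walk x1 p z -> reduced p -> x1 <> rng e ->
    z <> rng e -> all_in (sub_edge T) p.
  elim: p x1 => // f p IHp x1 /= [Ef Ep] [fx1 wp] rp x1e ze.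
  have Tf : sub_edge T f.
    case: (Ef) => // -[fe|fe]; last by case: x1e; rewrite -fx1 fe.
    case: p Ep wp rp {IHp} => [|g p /= [Eg Ep] [gf wp] rp].
      by move=> _ /= fz; case: ze; rewrite -fz fe.
    by case: (rp [::] e p); rewrite fe (srcE g)// gf fe.
  split=> //; apply: (IHp (rng f)) => //; first exact: reduced_behead rp.
  by move=> fe; apply: nTe; rewrite -fe; exact/sub_src/sub_bar.
have srce : src e <> rng e by move=> ee; rewrite -ee in nTe.
have T'_tree : is_tree T'.
  split; first by exists x0; left.
  - have ext x1 y1 : V x1 -> V y1 -> exists p, all_in E p /\ walk x1 p y1.
      have catP p q x2 y2 z2 : all_in E p -> walk x2 p y2 -> all_in E q ->
          walk y2 q z2 -> exists r, all_in E r /\ walk x2 r z2.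
        move=> Ep wp Eq wq; exists (p ++ q).
        elim: p x2 Ep wp => [x2 _ /= -> //|f p IHp x2 /= [Ef Ep] [fx wp]].
        by have [] := IHp _ Ep wp.
      have toe x2 : V x2 -> exists p, all_in E p /\ walk x2 p (src e).
        move=> [Tx2|->]; first by have [p [/TE]] := Tconn _ _ Tx2 Te; exists p.
        exists [:: bar e]; split=> /=; first by split=> //; right; right.
        by split=> //; rewrite /rng barK.
      have frome y2 : V y2 -> exists p, all_in E p /\ walk (src e) p y2.
        move=> [Ty2|->]; first by have [p [/TE]] := Tconn _ _ Te Ty2; exists p.
        by exists [:: e]; split=> //=; split=> //; right; left.
      move=> /toe[p [Ep wp]] /frome[q [Eq wq]].
      exact: catP Ep wp Eq wq.
    exact: ext.
  (* A nonempty reduced closed walk based at the leaf is [bar e], then a reduced closed walk of [T]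
     at [src e], then [e]. The middle is empty, so [bar e] and [e] are adjacent: a contradiction. *)
  - move=> x1 p /= Ep wp rp; have [x1e|x1e] := pselect (x1 = rng e); last first.
      exact: Tred (old _ _ _ Ep wp rp x1e x1e) wp rp.
    case: p Ep wp rp => // f p /= [Ef Ep] [fx1 wp] rp.
    have fE : f = bar e by apply: srcE => //; rewrite fx1.
    have fre : rng f = src e by rewrite fE /rng barK.
    case/lastP: p Ep wp rp => [_ /= fx _|p g /all_in_rcons[Ep Eg] /walk_rcons[wp gx] rp].
      by case: srce; rewrite -fre fx.
    have gE : g = e by apply: rngE => //; rewrite gx.
    have rp' : reduced p by apply: reduced_rcons; exact: reduced_behead rp.
    rewrite gE fre in wp; rewrite gE fE in rp.
    have p0E := Tred _ _ (old _ _ _ Ep wp rp' srce srce) wp rp'.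
    by case: (rp [::] (bar e) [::]); rewrite p0E barK.
have [] := Tmax T' T'_tree; first by move=> ? ?; left.
  by move=> ? ?; left.
move=> VT _; apply: nTe; rewrite -VT; by right.
Qed.
End SpanningTree.

(** * Universal properties *)

Section Unitaries.
Context (R : realType).

Lemma is_unitary_map (A B : cstarType R) (f : {shom A -> B}) (u : unitary A) :
  Defs.is_unitary (f (uval u)).
Proof.
have /andP[/eqP su /eqP us] := uvalP u.
by rewrite /Defs.is_unitary -star_map -!rmorphM/= su us rmorph1 eqxx.
Qed.

Definition unitary_map (A B : cstarType R) (f : {shom A -> B}) (u : unitary A) :=
  Unitary (is_unitary_map f u).

Lemma unitary_starM (A : cstarType R) (u : unitary A) : star (uval u) * uval u = 1.
Proof. by have /andP[/eqP] := uvalP u. Qed.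

Lemma unitary_Mstar (A : cstarType R) (u : unitary A) : uval u * star (uval u) = 1.
Proof. by have /andP[_ /eqP] := uvalP u. Qed.

Lemma unitary_conjE (A : cstarType R) (u : unitary A) (x y : A) :
  star (uval u) * x * uval u = y <-> x * uval u = uval u * y.
Proof.
split=> [<-|xu]; first by rewrite !mulrA unitary_Mstar mul1r.
by rewrite -mulrA xu mulrA unitary_starM mul1r.
Qed.

(** A relation [star u * f a * u = f' a] thereby becomes an equality of two homomorphisms, which can
    be checked on generators. *)
Lemma shom_conj (A B : cstarType R) (f : {shom A -> B}) (u : unitary B) :
  exists g : {shom A -> B}, forall a, g a = star (uval u) * f a * uval u.
Proof.
pose h a := star (uval u) * f a * uval u.
have [||||g gh] := @shom_of _ _ _ h; last by exists g.
- move=> c x y; rewrite /h linearP/= mulrDr mulrDl.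
  by rewrite -scalerAr -scalerAl.
- by rewrite /h rmorph1 mulr1 unitary_starM.
- move=> x y; rewrite /h rmorphM/= -(mulrA _ (uval u)) (mulrA (uval u)).
  by rewrite (mulrA (uval u)) unitary_Mstar mul1r !mulrA.
- by move=> x; rewrite /h star_map !starM starK mulrA.
Qed.

(* The symmetry [2 p - 1] turns commutation with the projection [p] into
   invariance under conjugation by a unitary. *)
Lemma projection_unitary (A : cstarType R) (p : A) : star p = p -> p * p = p ->
  exists u : unitary A, forall x,
    star (uval u) * x * uval u = x <-> x * p = p * x.
Proof.
move=> sp pp; pose v := p + p - 1.
have vv : v * v = 1.
  have qq : (p + p) * (p + p) = p + p + (p + p) by rewrite mulrDr !mulrDl pp.
  by rewrite /v mulrBr mulrBl !mulr1 mul1r qq addrK opprB addrC subrK.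
have vu : Defs.is_unitary v by rewrite /Defs.is_unitary /v starB starD sp star1 vv eqxx.
exists (Unitary vu) => x; rewrite unitary_conjE /= /v.
rewrite mulrBr mulrBl !mulrDr !mulrDl mulr1 mul1r.
split=> [/addIr xp|->//]; rewrite -(halfD (x * p)) -(halfD (p * x)).
by rewrite -!scalerDr xp.
Qed.
End Unitaries.

Section UniversalProperties.
Context (R : realType).

Lemma magic_unitary_map (A B : cstarType R) (f : {shom A -> B}) N
    (u : 'I_N -> 'I_N -> A) :
  magic_unitary u -> magic_unitary (fun i j => f (u i j)).
Proof.
move=> [us up ur uc]; split=> i.
- by move=> j; rewrite -star_map us.
- by move=> j; rewrite -rmorphM/= up.
- by rewrite -rmorph_sum ur rmorph1.
- by rewrite -rmorph_sum uc rmorph1.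
Qed.

(** Both maps solve the universal problem for the magic unitary that is the image under [f]. The
    analogues for group duals and fundamental quantum groups follow the same pattern. *)
Lemma quantum_perm_eq N (S : cqg R) (qp : quantum_perm N S) (B : cstarType R)
    (f g : {shom S -> B}) :
  (forall i j, f (qp_u qp i j) = g (qp_u qp i j)) -> f =1 g.
Proof.
move=> fg; have [_] := qp_univ qp (magic_unitary_map f (qp_magic qp)).
by apply=> // i j; rewrite fg.
Qed.

Lemma group_dual_eq (Gam : groupType) (H : cqg R) (gd : group_dual Gam H)
    (B : cstarType R) (f g : {shom H -> B}) :
  (forall x, f (uval (gd_elt gd x)) = g (uval (gd_elt gd x))) -> f =1 g.
Proof.
move=> fg; have [|_] := @gd_univ _ _ _ gd B (fun x => unitary_map f (gd_elt gd x)).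
  by move=> x y; apply: val_inj; rewrite gd_mul /= -rmorphM.
by apply=> // x; rewrite -fg.
Qed.

Lemma fundamental_rel_map (X : sgraph) (GG : cqg_graph R X) (T : subgraph X)
    (A B : cstarType R) (f : forall q, {shom gv GG q -> A}) (u : edge X -> unitary A)
    (h : {shom A -> B}) : fundamental_rel T f u ->
  fundamental_rel T (fun q => scomp h (f q)) (fun e => unitary_map h (u e)).
Proof.
move=> [uV us uT]; split=> [e|e b|e /uT/= ->] /=.
- by rewrite uV star_map.
- by rewrite -us !rmorphM.
- exact: rmorph1.
Qed.

Lemma fundamental_eq (X : sgraph) (GG : cqg_graph R X) (T : subgraph X) (G : cqg R)
    (pi : fundamental GG T G) (B : cstarType R) (f g : {shom G -> B}) :
  (forall q a, f (pi_v pi q a) = g (pi_v pi q a)) ->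
  (forall e, f (uval (pi_u pi e)) = g (uval (pi_u pi e))) -> f =1 g.
Proof.
move=> fgv fgu; have [_] := pi_univ pi (fundamental_rel_map f (pi_rel pi)).
by apply; split=> // *; rewrite /= (fgv, fgu).
Qed.

(** * Universal property of the free wreath product *)

Section Wreath.
Context (N : nat) (S : cqg R) (qp : quantum_perm N S) (H G : cqg R).
Context (iota : {shom H -> G}) (W : cstarType R) (w : wreath_alg qp iota W).

Lemma wr_commute i j a :
  wr_nu w i a * wr_perm w (qp_u qp i j) = wr_perm w (qp_u qp i j) * wr_nu w i a.
Proof.
apply/eqP; rewrite -subr_eq0; apply/eqP; rewrite /wr_nu /wr_perm /=.
rewrite -!rmorphM -rmorphB; apply/(cq_ker (wr_pi w)) => I [_ +].
by apply; exists i, j, a.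
Qed.

Lemma wr_nu_iota i j c : wr_nu w i (iota c) = wr_nu w j (iota c).
Proof. by rewrite /wr_nu /= !am_rel. Qed.

(** The maps [f i] glue on the amalgam, then join [s] on the free product. The kernel of the result
    is a closed ideal containing the relators, so it descends to the quotient. *)
Lemma wreath_ex (B : cstarType R) (f0 : {shom H -> B}) (f : 'I_N -> {shom G -> B})
    (s : {shom S -> B}) : (forall i c, f i (iota c) = f0 c) ->
  (forall i j a, f i a * s (qp_u qp i j) = s (qp_u qp i j) * f i a) ->
  exists phi : {shom W -> B}, (forall i a, phi (wr_nu w i a) = f i a) /\
    forall x, phi (wr_perm w x) = s x.
Proof.
move=> fiota fs; have [[h [_ hf]] _] := am_univ (wr_am w) fiota.
have [[k [kh ks]] _] := fp_univ (wr_fp w) h s.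
have [x|phi phiE] := quotient_factor (wr_pi w) (f := k).
  move=> /(_ [set z | k z = 0]); apply; split; first exact: shom_ker_closed.
  move=> _ [i [j [a ->]]] /=.
  by rewrite rmorphB !rmorphM/= !kh ks hf fs subrr.
by exists phi; split=> [i a|x]; rewrite /wr_nu /wr_perm /= phiE ?kh.
Qed.

Lemma wreath_eq (B : cstarType R) (f g : {shom W -> B}) : (0 < N)%N ->
  (forall i a, f (wr_nu w i a) = g (wr_nu w i a)) ->
  (forall i j, f (wr_perm w (qp_u qp i j)) = g (wr_perm w (qp_u qp i j))) ->
  f =1 g.
Proof.
move=> N0 fgn fgp y; have [x <-] := cq_surj (wr_pi w) y.
pose F := scomp f (wr_pi w); pose K := scomp g (wr_pi w).
have [_] := fp_univ (wr_fp w) (scomp F (fp_l (wr_fp w))) (scomp F (fp_r (wr_fp w))).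
move=> /(_ F K); apply; first by [].
split=> [z|z]; last first.
  apply: (quantum_perm_eq (f := scomp K (fp_r (wr_fp w)))
    (g := scomp F (fp_r (wr_fp w)))) => i j.
  exact/esym/fgp.
have [_] := @am_univ _ _ _ _ _ _ (wr_am w) B
  (scomp F (scomp (fp_l (wr_fp w)) (am_base (wr_am w))))
  (fun i => scomp F (scomp (fp_l (wr_fp w)) (am_nu (wr_am w) i)))
  (fun i c => congr1 (F \o fp_l (wr_fp w)) (am_rel (wr_am w) i c)).
move=> /(_ (scomp K (fp_l (wr_fp w))) (scomp F (fp_l (wr_fp w)))); apply=> //.
split=> [c|i a]; last exact/esym/fgn.
(* The amalgamated algebra is seen through copy 0, which exists as [0 < N]. *)
rewrite /= -(am_rel (wr_am w) (Ordinal N0)).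
exact/esym/fgn.
Qed.
End Wreath.

(** The base algebra consists of scalars, on which unital maps agree, so compatibility on the base
    is automatic. *)
Lemma free_wreath_ex N (S : cqg R) (qp : quantum_perm N S) (G W : cqg R)
    (w : free_wreath qp G W) (B : cstarType R) (f : 'I_N -> {shom G -> B})
    (s : {shom S -> B}) : (0 < N)%N ->
  (forall i j a, f i a * s (qp_u qp i j) = s (qp_u qp i j) * f i a) ->
  exists phi : {shom W -> B}, (forall i a, phi (wr_nu w i a) = f i a) /\
    forall x, phi (wr_perm w x) = s x.
Proof.
move=> N0 fs; pose f0 := scomp (f (Ordinal N0)) (fw_iota w).
have ff0 i c : f i (fw_iota w c) = f0 c.
  by have [z ->] := fw_trivial c; rewrite !linearZ/= !rmorph1.
exact: wreath_ex ff0 fs.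
Qed.
End UniversalProperties.

(** * The isomorphism *)

Lemma shom_id (R : realType) (A : cstarType R) : exists f : {shom A -> A}, f =1 id.
Proof. by have [] := @shom_of R A A id => // f; exists f. Qed.

Lemma shomM (R : realType) (A B : cstarType R) (f : {shom A -> B}) x y :
  f (x * y) = f x * f y.
Proof. exact: rmorphM. Qed.

Lemma shom_sum (R : realType) (A B : cstarType R) (f : {shom A -> B}) n
  (x : 'I_n -> A) : f (\sum_i x i) = \sum_i f (x i).
Proof. exact: rmorph_sum. Qed.

(** Read from right to left, it turns a nested value into the value of one homomorphism, as the
    uniqueness lemmas require. *)
Lemma scompE (R : realType) (A B C : cstarType R) (g : {shom B -> C})
  (f : {shom A -> B}) x : scomp g f x = g (f x).
Proof. by []. Qed.

(** * Structure maps of the graph of wreath products *)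

Section WreathGraph.
Context (R : realType) (X : sgraph).

Lemma cqg_castK (G H : cqg R) (eqGH : G = H) :
  cancel (cqg_cast eqGH) (cqg_cast (esym eqGH)).
Proof. by case: _ / eqGH. Qed.

Lemma cqg_castKV (G H : cqg R) (eqGH : G = H) :
  cancel (cqg_cast (esym eqGH)) (cqg_cast eqGH).
Proof. by case: _ / eqGH. Qed.

Lemma cqg_cast_shom (G H : cqg R) (eqGH : G = H) :
  exists f : {shom G -> H}, f =1 cqg_cast eqGH.
Proof. by case: _ / eqGH; exact: shom_id. Qed.

Lemma gr_shom (GG : cqg_graph R X) (e : edge X) :
  exists r : {shom ge GG e -> gv GG (rng e)}, r =1 @gr _ _ GG e.
Proof.
have [c cE] := cqg_cast_shom (esym (ge_bar GG e)).
by exists (scomp (gs GG (bar e)) c) => b; rewrite /= cE.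
Qed.

Context (N : nat) (S : cqg R) (qp : quantum_perm N S).
Context (GG GN : cqg_graph R X) (wg : wreath_graph qp GG GN).

(** The range maps inherit the formulas of the source maps, as [wg_bar_nu] moves the transport past
    [wr_nu]. *)
Lemma gr_nu e i (b : ge GG e) :
  gr (wr_nu (wg_e wg e) i b) = wr_nu (wg_v wg (rng e)) i (gr b).
Proof.
rewrite /gr -wg_s_nu; congr (gs GN (bar e) _).
by rewrite -{1}[b](cqg_castKV (ge_bar GG e)) -wg_bar_nu cqg_castK.
Qed.

Lemma gr_perm e x : gr (wr_perm (wg_e wg e) x) = wr_perm (wg_v wg (rng e)) x.
Proof.
rewrite /gr -wg_s_perm; congr (gs GN (bar e) _).
by rewrite -(wg_bar_perm wg e) cqg_castK.
Qed.
End WreathGraph.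

Section Isomorphism.
Context (R : realType) (N : nat) (N_ge1 : (1 <= N)%N).
Context (X : sgraph) (X_conn : connected_graph X).
Context (GG : cqg_graph R X) (T : subgraph X) (T_max : maximal_subtree T).
Context (G : cqg R) (piG : fundamental GG T G).
Context (S : cqg R) (qp : quantum_perm N S).
Context (Gamhat : cqg R) (gd : group_dual (loop_group piG) Gamhat).
Context (iota : dual_subgroup Gamhat G).
Context (iotaE : forall g : loop_group piG, iota (uval (gd_elt gd g)) = loop_val g).
Context (W : cqg R) (wr : wreath qp iota W).
Context (GN : cqg_graph R X) (wg : wreath_graph qp GG GN).
Context (P : cqg R) (piP : fundamental GN T P).

(** On the image of [wr_nu _ i] the maps s_e^N and r_e^N act as s_e and r_e, so the relations of [P]
    restrict to those of [G]. *)
Lemma copy_in_fundamental i : exists g : {shom G -> P},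
  (forall q a, g (pi_v piG q a) = pi_v piP q (wr_nu (wg_v wg q) i a)) /\
  forall e, g (uval (pi_u piG e)) = uval (pi_u piP e).
Proof.
have [uV us uT] := pi_rel piP.
have rel : fundamental_rel T
    (fun q => scomp (pi_v piP q) (wr_nu (wg_v wg q) i)) (pi_u piP).
  split=> // e b; rewrite (scompE (pi_v piP (src e))) (scompE (pi_v piP (rng e))).
  by rewrite -gr_nu -us wg_s_nu.
by have [[g gE] _] := pi_univ piG rel; exists g.
Qed.

(* The copies of C(S_N^+) sitting at the ends of a tree edge coincide because the
   corresponding unitary is 1, and the tree reaches every vertex. *)
Lemma perm_in_fundamental : exists s : {shom S -> P},
  forall q x, pi_v piP q (wr_perm (wg_v wg q) x) = s x.
Proof.
have [_ us uT] := pi_rel piP; have [[q0 _] _] := X_conn.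
exists (scomp (pi_v piP q0) (wr_perm (wg_v wg q0))) => q x; rewrite (scompE (pi_v piP q0)).
have [p [Tp wp]] : exists p, all_in (sub_edge T) p /\ walk q p q0.
  by case: (T_max) => -[_ + _] _; apply; exact: maximal_subtree_spans.
elim: p q Tp wp => [q _ /= -> //|e p IHp q /= [Te Tp] [<- wp]].
rewrite -(IHp _ Tp wp) -(gr_perm wg) -us wg_s_perm.
have [uV _ _] := pi_rel piP.
by rewrite uV (uT e Te) star1 mul1r mulr1.
Qed.

Lemma wreath_to_fundamental : exists (phi : {shom W -> P}) (s : {shom S -> P}),
  [/\ forall i q a, phi (wr_nu wr i (pi_v piG q a)) =
        pi_v piP q (wr_nu (wg_v wg q) i a),
      forall i e, phi (wr_nu wr i (uval (pi_u piG e))) = uval (pi_u piP e),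
      forall x, phi (wr_perm wr x) = s x
    & forall q x, pi_v piP q (wr_perm (wg_v wg q) x) = s x].
Proof.
have [uV us _] := pi_rel piP; have [s sE] := perm_in_fundamental.
have [g gP] := choice copy_in_fundamental.
have gv_ i q a : g i (pi_v piG q a) = pi_v piP q (wr_nu (wg_v wg q) i a).
  by have [+ _] := gP i; exact.
have gu i e : g i (uval (pi_u piG e)) = uval (pi_u piP e).
  by have [_ +] := gP i; exact.
(* Both structure maps of [e] carry [S] to its common copy identically, so the edge relation says
   that u_e commutes with this copy. *)
have su e x : s x * uval (pi_u piP e) = uval (pi_u piP e) * s x.
  apply/unitary_conjE; rewrite -{1}(sE (src e)) -(wg_s_perm wg) -uV us.
  by rewrite gr_perm sE.
(* For fixed [i] and [j], commuting with a projection is invariance under the unitary [v], an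
   equality of homomorphisms on [G]: it holds on the vertex algebras by the wreath relations over
   [q], and on the u_e by [su]. *)
have gs_comm i j a : g i a * s (qp_u qp i j) = s (qp_u qp i j) * g i a.
  have [ups upp _ _] := magic_unitary_map s (qp_magic qp).
  have [v vP] := projection_unitary (ups i j) (upp i j).
  have [c cE] := shom_conj (g i) v.
  apply/vP; rewrite -cE; apply: (fundamental_eq (pi := piG)) => [q b|e].
    rewrite cE; apply/vP; rewrite gv_ -(sE q) -!rmorphM; congr (pi_v piP q _).
    exact: wr_commute.
  by rewrite cE; apply/vP; rewrite gu su.
pose i0 := Ordinal N_ge1.
(* [g i] sends u_e to a unitary independent of [i]; induction on words extends this to the loop
   group. *)
have g_iota i c : g i (iota c) = g i0 (iota c).
  apply: (group_dual_eq (gd := gd) (f := scomp (g i) iota) (g := scomp (g i0) iota)).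
  move=> x; rewrite !(scompE _ iota) iotaE /loop_val.
  have /asboolP := sgenP x; elim=> [_ [e _ <-]|||].
  - by rewrite !gu.
  - by rewrite !rmorph1.
  - move=> u v _ uE _ vE; rewrite -[uval _]/(uval u * uval v).
    by rewrite !rmorphM/= uE vE.
  - by move=> u _ uE; rewrite -[uval _]/(star (uval u)) !star_map uE.
have [phi [phin phip]] :=
  @wreath_ex _ _ _ _ _ _ _ _ wr _ (scomp (g i0) iota) g s g_iota gs_comm.
by exists phi, s; split=> // *; rewrite phin ?gv_ ?gu.
Qed.

Lemma fundamental_to_wreath : exists psi : {shom P -> W},
  [/\ forall i q a, psi (pi_v piP q (wr_nu (wg_v wg q) i a)) =
        wr_nu wr i (pi_v piG q a),
      forall i e, psi (uval (pi_u piP e)) = wr_nu wr i (uval (pi_u piG e))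
    & forall q x, psi (pi_v piP q (wr_perm (wg_v wg q) x)) = wr_perm wr x].
Proof.
have [uV us uT] := pi_rel piG; pose i0 := Ordinal N_ge1.
have f_ex q : exists f : {shom gv GN q -> W},
    (forall i a, f (wr_nu (wg_v wg q) i a) = wr_nu wr i (pi_v piG q a)) /\
    forall x, f (wr_perm (wg_v wg q) x) = wr_perm wr x.
  apply: (free_wreath_ex (wg_v wg q) (f := fun i => scomp (wr_nu wr i) (pi_v piG q))) => //.
  by move=> i j a; exact: wr_commute.
pose f q := projT1 (cid (f_ex q)).
have fn q i a : f q (wr_nu (wg_v wg q) i a) = wr_nu wr i (pi_v piG q a).
  by rewrite /f; case: cid => ? [].
have fp q x : f q (wr_perm (wg_v wg q) x) = wr_perm wr x.
  by rewrite /f; case: cid => ? [].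
(* Copy 0 is chosen, but u_e lies in the image of [iota], so every copy gives the same unitary. *)
pose v e := unitary_map (wr_nu wr i0) (pi_u piG e).
have vE i e : uval (v e) = wr_nu wr i (uval (pi_u piG e)).
  have ge_ : `[< generated (range (pi_u piG)) (pi_u piG e) >].
    by apply/asboolP; apply: gen_in; exists e.
  have := iotaE (SubgroupGen ge_); rewrite /loop_val /= => <-.
  exact: wr_nu_iota.
(* On the generator u_ij, reading [v e] in copy [i] makes the wreath relation applicable. *)
have vp e x : star (uval (v e)) * wr_perm wr x * uval (v e) = wr_perm wr x.
  have [c cE] := shom_conj (wr_perm wr) (v e).
  rewrite -cE; apply: (quantum_perm_eq (qp := qp)) => i j.
  by rewrite cE; apply/unitary_conjE; rewrite (vE i) wr_commute.
have rel : fundamental_rel T f v.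
  split=> [e|e b|e /uT ue]; last by rewrite (vE i0) ue rmorph1.
    by rewrite !(vE i0) uV star_map.
  (* Both sides of the edge relation are homomorphisms on the wreath product over [e]. On copy [i]
     it is the relation of [G] seen through [wr_nu wr i], on [S] it is [vp]. *)
  have [r rE] := gr_shom GN e; rewrite -rE.
  have [c cE] := shom_conj (scomp (f (src e)) (gs GN e)) (v e).
  rewrite {1}(vE i0) uV star_map -(vE i0).
  rewrite -(scompE (f (src e))) -(scompE (f (rng e))) -cE.
  move: b; apply: (wreath_eq (w := wg_e wg e)) => // [i a|i j]; rewrite cE.
    rewrite !(scompE (f _)) rE wg_s_nu gr_nu !fn !(vE i) -star_map -!rmorphM.
    by rewrite -us uV.
  by rewrite !(scompE (f _)) rE wg_s_perm gr_perm !fp vp.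
have [[psi [psiv psiu]] _] := pi_univ piP rel.
exists psi; split=> [i q a|i e|q x]; first by rewrite psiv fn.
  by rewrite psiu (vE i).
by rewrite psiv fp.
Qed.

Lemma tensor_hom_tpair (A B C A' B' C' : cstarType R) (t : cstar_tensor A B C)
    (t' : cstar_tensor A' B' C') (f : {shom A -> A'}) (g : {shom B -> B'})
    (h : {shom C -> C'}) a b :
  is_tensor_hom t t' f g h -> h (tpair t a b) = tpair t' (f a) (g b).
Proof. by move=> [hl hr]; rewrite /tpair rmorphM/= hl hr. Qed.

Lemma intertwines_wreath_iso (phi : {shom W -> P}) (s : {shom S -> P})
    (h : {shom cqg_T W -> cqg_T P}) :
  is_tensor_hom (cqg_t W) (cqg_t P) phi phi h ->
  (forall i q a, phi (wr_nu wr i (pi_v piG q a)) =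
     pi_v piP q (wr_nu (wg_v wg q) i a)) ->
  (forall i e, phi (wr_nu wr i (uval (pi_u piG e))) = uval (pi_u piP e)) ->
  (forall x, phi (wr_perm wr x) = s x) ->
  (forall q x, pi_v piP q (wr_perm (wg_v wg q) x) = s x) ->
  forall x, cqg_D P (phi x) = h (cqg_D W x).
Proof.
move=> hT phiv phiu phip piPs x; have [hl hr] := hT.
rewrite -(scompE (cqg_D P)) -(scompE h); move: x.
apply: (wreath_eq (w := wr)) => // [i a|i j]; last first.
  rewrite !(scompE (cqg_D P)) !(scompE h) phip wr_D_perm shom_sum.
  have [[q0 _] _] := X_conn; have [k [kT kD]] := pi_D_v piP q0.
  rewrite -(piPs q0) kD wr_D_perm shom_sum; apply: eq_bigr => l _.
  by rewrite (tensor_hom_tpair _ _ kT) (tensor_hom_tpair _ _ hT) !piPs !phip.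
have [m [mT mD]] := wr_D_nu wr i.
rewrite -(scompE _ (wr_nu wr i)) -[RHS](scompE _ (wr_nu wr i)); move: a.
apply: (fundamental_eq (pi := piG)) => [q a|e]; last first.
  rewrite !(scompE _ (wr_nu wr i)) !(scompE (cqg_D P)) !(scompE h) phiu mD.
  rewrite shom_sum pi_D_u.
  (* A row of the magic unitary sums to 1, which supplies the sum over [j] found in the
     comultiplication of [W]. *)
  have -> : tpair (cqg_t P) (uval (pi_u piP e)) (uval (pi_u piP e)) =
      \sum_j tpair (cqg_t P) (uval (pi_u piP e)) (uval (pi_u piP e)) *
        tl (cqg_t P) (s (qp_u qp i j)).
    by rewrite -mulr_sumr -!rmorph_sum; case: (qp_magic qp) => _ _ -> _;
      rewrite !rmorph1 mulr1.
  apply: eq_bigr => j _; rewrite pi_D_u (tensor_hom_tpair _ _ (mT j)).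
  by rewrite shomM (tensor_hom_tpair _ _ hT) hl phip !phiu.
rewrite !(scompE _ (wr_nu wr i)) !(scompE (cqg_D P)) !(scompE h) phiv mD.
have [k [kT kD]] := pi_D_v piP q; have [l [lT lD]] := pi_D_v piG q.
have [n [nT nD]] := wr_D_nu (wg_v wg q) i.
rewrite kD nD lD !shom_sum; apply: eq_bigr => j _.
rewrite !shomM hl phip (proj1 kT) piPs; congr (_ * _).
rewrite -(scompE k) -(scompE (m j)) -(scompE h).
(* The coproduct of [a] is generalised to any element of the tensor square, where homomorphisms
   equal on both legs coincide. *)
move: (cqg_D _ a); apply: (tensor_eq_shom (t := cqg_t _)) => b.
  rewrite (scompE k) (scompE h) (scompE (m j)).
  by rewrite (proj1 (nT j)) (proj1 kT) (proj1 lT) (proj1 (mT j)) hl phiv.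
rewrite (scompE k) (scompE h) (scompE (m j)).
by rewrite (proj2 (nT j)) (proj2 kT) (proj2 lT) (proj2 (mT j)) hr phiv.
Qed.
End Isomorphism.

Unset Implicit Arguments.
Set Strict Implicit.

Theorem theorem6p3 (R : realType) (N : nat) (N_ge1 : (1 <= N)%N)
    (X : sgraph) (X_conn : connected_graph X)
    (GG : cqg_graph R X) (T : subgraph X) (T_max : maximal_subtree T)
    (G : cqg R) (piG : fundamental GG T G)
    (S : cqg R) (qp : quantum_perm N S)
    (Gamhat : cqg R) (gd : group_dual (loop_group piG) Gamhat)
    (iota : dual_subgroup Gamhat G)
    (iotaE : forall g : loop_group piG, iota (uval (gd_elt gd g)) = loop_val g)
    (W : cqg R) (wr : wreath qp iota W)
    (GN : cqg_graph R X) (wg : wreath_graph qp GG GN)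
    (P : cqg R) (piP : fundamental GN T P) :
  cqg_iso W P.
Proof.
have [phi [s [phiv phiu phip piPs]]] :=
  wreath_to_fundamental N_ge1 X_conn T_max iotaE wr wg piP.
have [psi [psiv psiu psip]] := fundamental_to_wreath N_ge1 iotaE wr wg piP.
(* Each composite fixes the generators, hence is the identity by uniqueness. *)
have phiK : cancel phi psi.
  have [idW idE] := shom_id W; move=> x; rewrite -[RHS]idE -(scompE psi); move: x.
  apply: (wreath_eq (w := wr)) => // [i a|i j]; rewrite idE (scompE psi).
    rewrite -(scompE psi) -(scompE _ (wr_nu wr i)); move: a.
    by apply: (fundamental_eq (pi := piG)) => [q a|e];
      rewrite (scompE _ (wr_nu wr i)) (scompE psi) (phiv, phiu) (psiv, psiu i).
  have [[q0 _] _] := X_conn.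
  by rewrite phip -(piPs q0) psip.
have psiK : cancel psi phi.
  have [idP idE] := shom_id P; move=> x; rewrite -[RHS]idE -(scompE phi); move: x.
  apply: (fundamental_eq (pi := piP)) => [q a|e]; rewrite idE (scompE phi); last first.
    by rewrite (psiu (Ordinal N_ge1)) phiu.
  rewrite -(scompE phi) -(scompE _ (pi_v piP q)); move: a.
  apply: (wreath_eq (w := wg_v wg q)) => // [i a|i j];
    rewrite (scompE _ (pi_v piP q)) (scompE phi).
    by rewrite psiv phiv.
  by rewrite psip phip piPs.
have phi_bij : bijective phi by exists psi.
(* The tensor square of [phi] exists on the minimal tensor products because [phi] is bijective. *)
have [h hT] := tensor_iso_hom (cqg_t W) (cqg_t P) phi_bij phi_bij.
exists phi; split=> //; exists h; split=> // x.
exact: (intertwines_wreath_iso N_ge1 X_conn hT phiv phiu phip piPs).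
Qed.
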